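(* Let $G$ be an abelian group of order $n$ and let $n = p_1^{m_1} p_2^{m_2}\cdots p_k^{m_k}$ be the prime decomposition of $n$ (with $p_1,\dots,p_k$ distinct primes and each $m_i\ge 1$). For $1\le i\le k$ let $G(p_i) = \{x\in G : x^{p_i^{m_i}} = e\}$. Then for every non-identity element $x = x_1 x_2 \cdots x_k$ of $G$, where $x_i \in G(p_i)$ for each $i$: (i) $d_G^+(x)=\Big(\prod_{i=1}^{k}\big(d_{G(p_i)}^+(x_i)+1\big)\Big)-1$; (ii) $d_G^{\pm}(x)=\Big(\prod_{i=1}^{k}\big(d_{G(p_i)}^{\pm}(x_i)+1\big)\Big)-1$; (iii) $d_G^-(x)=\Big(\prod_{i=1}^{k}\big(d_{G(p_i)}^-(x_i)+1\big)\Big)-1$.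
   Context: Groups are finite, non-trivial and written multiplicatively; $e$ is the identity of $G$. Each $G(p_i)$ is a (normal) subgroup of $G$ of order $p_i^{m_i}$, and $G$ is the internal direct product of $G(p_1),\dots,G(p_k)$. The directed power graph $\overrightarrow{\mathcal{G}}(A)$ of a group $A$ is the digraph with vertex set $A$ in which there is an edge from a vertex $u$ to a different vertex $v$ whenever $v$ is a power of $u$. For $a\in A$: $d_A^+(a)$ is the out-degree of $a$ in $\overrightarrow{\mathcal{G}}(A)$ (number of edges with tail $a$); $d_A^-(a)$ is the in-degree of $a$ in $\overrightarrow{\mathcal{G}}(A)$ (number of edges with head $a$); and $d_A^{\pm}(a)$ is the number of bi-directional edges incident on $a$ in $\overrightarrow{\mathcal{G}}(A)$, where a bi-directional edge is a pair of edges joining the same two vertices in opposite directions (counted once), so $d_A^{\pm}(a)$ is the number of $b\in A$, $b\ne a$, such that each of $a,b$ is a power of the other. These quantities are taken with $A=G$ and $A=G(p_i)$ respectively, each computed in the directed power graph of the indicated group. *)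

(* Defs.v *)
From HB Require Import structures.
From mathcomp Require Import all_boot all_order all_fingroup.

Set Implicit Arguments.
Unset Strict Implicit.
Unset Printing Implicit Defensive.

Local Open Scope group_scope.

Section PowerDigraph.

Variable gT : finGroupType.
Implicit Types (A : {set gT}) (G : {group gT}) (a u v : gT).

(* In a finite group the powers of u are exactly the elements of <[u]>;
   [power_arcP] gives the form with explicit exponents. *)
Definition power_arc A : rel gT :=
  fun u v => [&& u \in A, v \in A, u != v & v \in <[u]>].

Lemma power_arcP A u v :
  reflect [/\ u \in A, v \in A, u != v & exists n, v = u ^+ n]
          (power_arc A u v).
Proof.
by apply: (iffP and4P) => -[uA vA uv] /cycleP vu; split=> //; apply/cycleP.
Qed.

Definition out_deg A a : nat := #|[set b | power_arc A a b]|.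

Definition in_deg A a : nat := #|[set b | power_arc A b a]|.

Definition bi_deg A a : nat := #|[set b | power_arc A a b && power_arc A b a]|.

Definition torsion_part A (q : nat) : {set gT} := [set x in A | x ^+ q == 1].

Lemma torsion_part_group_set G q : abelian G -> group_set (torsion_part G q).
Proof.
move=> /centsP abG; apply/group_setP; split=> [|x y].
  by rewrite inE group1 expg1n eqxx.
rewrite !inE => /andP[xG /eqP xq] /andP[yG /eqP yq].
by rewrite groupM //= expgMn ?xq ?yq ?mulg1 //; apply: abG.
Qed.

End PowerDigraph.

(* Main.v *)
(* Adding 1 to a degree makes the vertex count as its own neighbour, so
   deg + 1 is the number of b such that b \in <[a]> (resp. a \in <[b]>, or both).
   For a = x in G abelian, b \in <[x]> holds if and only if it holds between the
   p_i-components of b and x for every i, so these b are counted by the product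
   of the corresponding counts in the primary components. *)
Require Import Defs.
From HB Require Import structures.
From mathcomp Require Import all_boot all_order all_fingroup.
From mathcomp Require Import cyclic pgroup.

Set Implicit Arguments.
Unset Strict Implicit.
Unset Printing Implicit Defensive.

Local Open Scope group_scope.

Section ClosedNeighbourhoods.

Variables (gT : finGroupType) (A : {set gT}) (a : gT).
Hypothesis aA : a \in A.

Lemma card_reflexive_neighbours (r : rel gT) : r a a ->
  (#|[set b in A | (a != b) && r a b]| + 1)%N = #|[set b in A | r a b]|.
Proof.
move=> raa; rewrite [RHS](cardsD1 a) inE aA raa addnC; congr (_ + _)%N.
by apply: eq_card => b; rewrite !inE eq_sym; case: (b \in A); rewrite ?andbF.
Qed.

Lemma out_degD1 : (out_deg A a + 1)%N = #|[set b in A | b \in <[a]>]|.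
Proof.
rewrite -(card_reflexive_neighbours (r := fun a b => b \in <[a]>)) ?cycle_id //.
by congr (_ + 1)%N; apply: eq_card => b; rewrite !inE /power_arc aA.
Qed.

Lemma in_degD1 : (in_deg A a + 1)%N = #|[set b in A | a \in <[b]>]|.
Proof.
rewrite -(card_reflexive_neighbours (r := fun a b => a \in <[b]>)) ?cycle_id //.
congr (_ + 1)%N; apply: eq_card => b.
by rewrite !inE /power_arc aA (eq_sym b).
Qed.

Lemma bi_degD1 :
  (bi_deg A a + 1)%N = #|[set b in A | (b \in <[a]>) && (a \in <[b]>)]|.
Proof.
rewrite -(card_reflexive_neighbours
  (r := fun a b => (b \in <[a]>) && (a \in <[b]>))) ?cycle_id //.
congr (_ + 1)%N; apply: eq_card => b.
rewrite !inE /power_arc aA (eq_sym b) /=.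
by case: (b \in A); case: (a == b) => //=; case: (b \in <[a]>).
Qed.

End ClosedNeighbourhoods.

Section PrimaryComponents.

Variables (gT : finGroupType) (G : {group gT}).
Hypothesis abelG : abelian G.
Variables (k : nat) (p m : 'I_k -> nat).
Hypotheses (p_inj : injective p) (p_prime : forall i, prime (p i)).
Hypothesis cardG : #|G| = (\prod_(i < k) p i ^ m i)%N.

Local Notation tors i := (torsion_part G (p i ^ m i)).

Lemma torsion_p_elt i y : y \in tors i -> (p i).-elt y.
Proof.
rewrite inE => /andP[_]; rewrite -order_dvdn => /pnat_dvd; apply.
by rewrite pnatX pnat_id ?p_prime.
Qed.

(** The order of the [p i]-part of [b] divides [#|G|] and is coprime to every factor [p j ^ m j]
    with [j != i], the primes being distinct; by Gauss it divides [p i ^ m i]. *)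
Lemma constt_torsion i b : b \in G -> b.`_(p i) \in tors i.
Proof.
move=> bG; rewrite inE groupX //= -order_dvdn.
have: #[b.`_(p i)] %| #|G| by rewrite order_dvdG ?groupX.
rewrite cardG (bigD1 i) //= Gauss_dvdl //.
have pi_b : (p i).-nat #[b.`_(p i)] by apply: p_elt_constt.
elim/big_ind: _ => [|u v cu cv|j ji]; first exact: coprimen1.
  by rewrite coprimeMr cu.
apply: pnat_coprime pi_b _.
rewrite pnatX; apply/orP; left.
rewrite p'natE ?p_prime // dvdn_prime2 ?p_prime //.
by apply: contraNneq ji => /p_inj ->.
Qed.

(** The quotient [b * c^-1] has trivial [p i]-part for every [i], so its order is coprime to [#|G|];
    since that order also divides [#|G|], it is 1. *)
Lemma constt_inj : {in G &, forall b c,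
  (forall i, b.`_(p i) = c.`_(p i)) -> b = c}.
Proof.
move=> b c bG cG bc; apply/eqP; rewrite eq_mulgV1 -order_eq1.
have zG : b * c^-1 \in G by rewrite groupM ?groupV.
have z1 i : (b * c^-1).`_(p i) = 1.
  rewrite consttM ?consttV ?bc ?mulgV //.
  by apply: (centsP abelG); rewrite ?groupV.
have: coprime #[b * c^-1] #|G|.
  rewrite cardG; elim/big_ind: _ => [|u v cu cv|i _]; first exact: coprimen1.
    by rewrite coprimeMr cu.
  apply: p'nat_coprime (_ : (p i).-nat _); last by rewrite pnatX pnat_id ?p_prime.
  exact/constt1P/z1.
by move/eqP; rewrite (gcdn_idPl (order_dvdG zG)) => ->.
Qed.

(** Taking [p i]-parts is multiplicative on commuting elements, and it fixes [y i] while killing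
    each [y j] with [j != i], which is a [p j]-element for another prime. *)
Lemma constt_prod (y : 'I_k -> gT) i : (forall j, y j \in tors j) ->
  (\prod_j y j).`_(p i) = y i.
Proof.
move=> yt; have yG j : y j \in G by move: (yt j); rewrite inE => /andP[].
have consttMr (s : seq 'I_k) :
    (\prod_(j <- s) y j).`_(p i) = \prod_(j <- s) (y j).`_(p i).
  elim: s => [|j s IHs]; first by rewrite !big_nil constt1.
  rewrite !big_cons consttM ?IHs //.
  by apply: (centsP abelG) => //; apply: group_prod.
have yE j : (y j).`_(p i) = if j == i then y i else 1.
  case: eqP => [-> | /eqP ji]; first by rewrite constt_p_elt ?torsion_p_elt.
  apply/constt1P; apply: sub_p_elt (torsion_p_elt (yt j)) => q.
  by rewrite !inE => /eqP ->; apply: contraNneq ji => /p_inj ->.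
rewrite consttMr (eq_bigr _ (fun j _ => yE j)).
by rewrite -big_mkcond big_pred1_eq.
Qed.

Lemma prod_constt_ord b : b \in G -> \prod_(i < k) b.`_(p i) = b.
Proof.
move=> bG; apply: constt_inj => // [|i]; first by apply: group_prod => i; rewrite groupX.
by rewrite constt_prod // => j; apply: constt_torsion.
Qed.

(** The parts of [a ^+ n] are the [n]-th powers of the parts of [a]. Conversely, each part of [a] is
    itself a power of [a], so [<[a]>] contains every part of [b] and hence their product. *)
Lemma mem_cycle_constt : {in G &, forall a b,
  (b \in <[a]>) = [forall i, b.`_(p i) \in <[a.`_(p i)]>]}.
Proof.
move=> a b aG bG; apply/idP/forallP => [/cycleP[n ->] i | ba].
  by rewrite consttX mem_cycle.
rewrite -(prod_constt_ord bG); apply: group_prod => i _.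
by apply: subsetP (ba i); rewrite cycle_subG cycle_constt.
Qed.

(** Multiplying out families of components is a bijection onto the set on the left, with inverse [b]
    to its family of [p i]-parts. The predicate depends on [i] so that it can mention the component
    [x_ i]. *)
Lemma card_constt (P : 'I_k -> pred gT) :
  #|[set b in G | [forall i, P i b.`_(p i)]]|
    = (\prod_i #|[set b in tors i | P i b]|)%N.
Proof.
pose D := setXn (fun i : 'I_k => [set b in tors i | P i b]).
pose f (y : {dffun forall i : 'I_k, gT}) := \prod_i y i.
have Dtors y : y \in D -> forall i, y i \in tors i.
  by move=> /setXnP yD i; have := yD i; rewrite inE => /andP[].
rewrite -cardsXn -/D -(card_in_imset (f := f) (D := D)) => [|y z yD zD fyz].
  apply: eq_card => b; rewrite inE; apply/andP/imsetP => [[bG /forallP Pb] | [y yD ->]].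
    exists [ffun i => b.`_(p i)].
      by apply/setXnP => i; rewrite inE ffunE constt_torsion ?Pb.
    by rewrite -[LHS]prod_constt_ord //; apply: eq_bigr => i _; rewrite ffunE.
  split; first by apply: group_prod => i _; have := Dtors y yD i; rewrite inE => /andP[].
  apply/forallP => i; rewrite constt_prod; last exact: Dtors.
  by have/setXnP/(_ i) := yD; rewrite inE => /andP[].
(* Injectivity of [f] on [D]: [y i] is recovered as the [p i]-part of the product. *)
apply/ffunP => i.
by rewrite -(constt_prod i (Dtors y yD)) -(constt_prod i (Dtors z zD)) -/(f y) fyz.
Qed.

End PrimaryComponents.

Theorem theorem3p6 (gT : finGroupType) (G : {group gT})
    (abelG : abelian G)
    (k : nat) (p m : 'I_k -> nat)
    (p_inj : injective p)
    (p_prime : forall i : 'I_k, prime (p i))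
    (m_gt0 : forall i : 'I_k, (0 < m i)%N)
    (cardG : #|G| = (\prod_(i < k) p i ^ m i)%N)
    (x : gT) (xG : x \in G) (x_neq1 : x != 1)
    (x_ : 'I_k -> gT)
    (x_in : forall i : 'I_k, x_ i \in torsion_part G (p i ^ m i)%N)
    (x_def : x = \prod_(i < k) x_ i) :
  [/\ out_deg G x =
        ((\prod_(i < k) (out_deg (torsion_part G (p i ^ m i)) (x_ i) + 1)) - 1)%N,
      bi_deg G x =
        ((\prod_(i < k) (bi_deg (torsion_part G (p i ^ m i)) (x_ i) + 1)) - 1)%N
    & in_deg G x =
        ((\prod_(i < k) (in_deg (torsion_part G (p i ^ m i)) (x_ i) + 1)) - 1)%N].
Proof.
(* The given factorization of [x] is forced to be the one into its [p i]-parts. *)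
have xE i : x.`_(p i) = x_ i by rewrite x_def (constt_prod abelG p_inj p_prime i x_in).
have cycE := mem_cycle_constt abelG p_inj p_prime cardG.
have cardE := card_constt abelG p_inj p_prime cardG.
(* Each degree [d] is written [(d + 1) - 1], which is exact in [nat], so only the counts including
   the vertex itself remain to be compared. *)
split; rewrite -[LHS](addnK 1); congr (_ - 1)%N.
- under eq_bigr do rewrite out_degD1 //.
  rewrite out_degD1 // -cardE; apply: eq_card => b; rewrite !inE.
  case bG: (b \in G) => //=; rewrite cycE //.
  by apply: eq_forallb => i; rewrite xE.
- under eq_bigr do rewrite bi_degD1 //.
  rewrite bi_degD1 // -cardE; apply: eq_card => b; rewrite !inE.
  case bG: (b \in G) => //=; rewrite !cycE //.
  (* The two directions of divisibility into components are merged index by index, as [card_constt]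
     needs a single predicate for each [i]. *)
  apply/andP/forallP => [[/forallP bx /forallP xb] i | h].
    by rewrite -xE bx xb.
  by split; apply/forallP => i; have/andP[] := h i; rewrite xE.
- under eq_bigr do rewrite in_degD1 //.
  rewrite in_degD1 // -cardE; apply: eq_card => b; rewrite !inE.
  case bG: (b \in G) => //=; rewrite cycE //.
  by apply: eq_forallb => i; rewrite xE.
Qed.
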